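(* Let $b_d$ be the largest dimension possible of a poset formed by two adjacent levels of a Boolean lattice over a universe of $d$ elements. Then $$\tfrac12\, b_d \;\leq\; \mathrm{boxicity}(K_2^d) \;\leq\; 3 b_d .$$ Furthermore, $\mathrm{boxicity}(K_2^d) \leq 12 \log d/\log\log d$.
   Context: All graphs are finite, undirected and simple. All logarithms are to base $2$. A $k$-box is a Cartesian product of $k$ closed intervals of $\mathbb{R}$. The boxicity of a graph $G$ is the smallest natural number $k$ (with $0$ allowed; complete graphs have boxicity $0$) such that there is a function $f$ mapping each vertex of $G$ to a $k$-box so that any two distinct vertices $u,v$ are adjacent in $G$ iff $f(u)\cap f(v)\neq\emptyset$. $K_2^d$ is the $d$-dimensional hypercube, i.e. the graph on $\{0,1\}^d$ with two vertices adjacent iff they differ in exactly one coordinate (the Cartesian product of $d$ copies of $K_2$). The $d$-dimensional Boolean lattice is the poset on $\{0,1\}^d$ (equivalently, subsets of a $d$-element set) with $u\le v$ iff $u(i)\leq v(i)$ for all $i$. Its $i$-th level, $0\le i\le d$, is the set of elements with exactly $i$ ones; a poset formed by two adjacent levels is the subposet induced on the union of levels $j-1$ and $j$ for some $j\in\{1,\ldots,d\}$, and $b_d$ is the maximum of the dimensions of these $d$ posets. The dimension of a poset $P$ is the minimum positive integer $k$ such that there are $k$ linear extensions of $P$ with the property that, for distinct $x,y$, $x<y$ in $P$ iff $x<y$ in all of these linear extensions.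
   Formalization: The lower bound is stated for d ≥ 2, since at d = 1 it fails (b_1 = 1 but boxicity(K_2) = 0); the upper bound 3b_d is stated for d ≥ 1 (b_0 is undefined); the bound 12 log d/log log d is stated for d ≥ 3, where log log d is defined and nonzero. *)

(* Defs.v *)
From HB Require Import structures.
From mathcomp Require Import all_boot all_order all_algebra.
From mathcomp Require Import boolp classical_sets reals exp.

Set Implicit Arguments.
Unset Strict Implicit.
Unset Printing Implicit Defensive.

Import Order.TTheory GRing.Theory Num.Theory.

Local Open Scope ring_scope.
Local Open Scope classical_set_scope.

Definition log2 (R : realType) (x : R) : R := ln x / ln 2.

Record sgraph := SGraph {
  vertex :> finType;
  adj : rel vertex;
  adj_sym : symmetric adj;
  adj_irr : irreflexive adj
}.

(* The bounds [a i <= b i] make the factors, hence the box, nonempty.  There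
   is exactly one 0-box, namely the whole (one-point) space, so complete
   graphs are represented with k = 0. *)
Definition is_box (R : realType) (k : nat) (B : set ('I_k -> R)) : Prop :=
  exists a b : 'I_k -> R,
    (forall i, a i <= b i) /\ B = [set x | forall i, a i <= x i <= b i].

Definition box_representation (R : realType) (G : sgraph) (k : nat)
    (f : G -> set ('I_k -> R)) : Prop :=
  (forall v, is_box (f v)) /\
  (forall u v, u != v -> (adj u v <-> f u `&` f v !=set0)).

Definition box_representable (R : realType) (G : sgraph) (k : nat) : Prop :=
  exists f : G -> set ('I_k -> R), box_representation f.

(* One coordinate per vertex w: w gets {0}, its neighbours [0, 1] and all
   other vertices {1}. *)
Lemma box_representable_ex (R : realType) (G : sgraph) :
  exists k, `[< box_representable R G k >].
Proof.
exists #|G|; apply/asboolP.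
pose a (v : G) (i : 'I_#|G|) : R :=
  if (v == enum_val i) || adj v (enum_val i) then 0 else 1.
pose b (v : G) (i : 'I_#|G|) : R := if v == enum_val i then 0 else 1.
exists (fun v => [set x | forall i, a v i <= x i <= b v i]); split=> [v|u v uv].
  exists (a v), (b v); split=> // i.
  by rewrite /a /b; case: eqP => //=; case: adj.
split=> [auv|[x [xu xv]]].
  pose x (i : 'I_#|G|) : R := if (u == enum_val i) || (v == enum_val i) then 0 else 1.
  exists x; split=> i; rewrite /a /b /x.
  - case: (eqVneq u (enum_val i)) => [ui|_] /=; first by rewrite lexx.
    case: (eqVneq v (enum_val i)) => [<-|_] /=; first by rewrite auv lexx ler01.
    by case: adj; rewrite lexx ?ler01.
  - case: (eqVneq v (enum_val i)) => [vi|_] /=; first by rewrite orbT lexx.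
    rewrite orbF; case: (eqVneq u (enum_val i)) => [<-|_] /=.
      by rewrite adj_sym auv lexx ler01.
    by case: adj; rewrite lexx ?ler01.
have /= := xu (enum_rank u); have /= := xv (enum_rank u).
rewrite /a /b enum_rankK eqxx /= eq_sym (negPf uv) /= adj_sym.
case: adj => //= /andP[x1 _] /andP[_ x0].
by have := le_trans x1 x0; rewrite ler10.
Qed.

Definition boxicity (R : realType) (G : sgraph) : nat :=
  ex_minn (box_representable_ex R G).

Section PosetDimension.
Context {disp : Order.disp_t} (T : finPOrderType disp).
Implicit Type L : rel T.

(* [total L] includes reflexivity. *)
Definition linear_extension L : Prop :=
  [/\ total L, antisymmetric L, transitive L
    & forall x y : T, (x <= y)%O -> L x y].

Definition realizer (k : nat) (L : 'I_k -> rel T) : Prop :=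
  (forall i, linear_extension (L i)) /\
  (forall x y : T, x != y -> ((x < y)%O <-> forall i, L i x y)).

Definition realizable (k : nat) : Prop :=
  exists L : 'I_k -> rel T, realizer L.

(* For p = Some (a, b), add a <= b to the order unless b <= a. *)
Let le_add (p : option (T * T)) : rel T := fun x y => (x <= y)%O ||
  (if p is Some (a, b) then [&& ~~ (b <= a)%O, (x <= a)%O & (b <= y)%O]
   else false).

Let ht p (x : T) : nat := #|[set y | le_add p y x]%SET|.

Let ext p : rel T := fun x y =>
  (ht p x < ht p y)%N ||
  ((ht p x == ht p y) && (enum_rank x <= enum_rank y)%N).

Let le_add_trans p : transitive (le_add p).
Proof.
move=> y x z; rewrite /le_add; case: p => [[a b]|]; last first.
  by rewrite !orbF; apply: le_trans.
case/orP=> [xy|/and3P[n xa yb]]; case/orP=> [yz|/and3P[n' ya zb]].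
- by rewrite (le_trans xy yz).
- by rewrite n' (le_trans xy ya) zb orbT.
- by rewrite n xa (le_trans yb yz) orbT.
- by rewrite (le_trans yb ya) in n.
Qed.

Let le_add_anti p x y : le_add p x y -> le_add p y x -> x = y.
Proof.
rewrite /le_add; case: p => [[a b]|]; last first.
  by rewrite !orbF => xy yx; apply/le_anti; rewrite xy yx.
case/orP=> [xy|/and3P[n xa yb]]; case/orP=> [yx|/and3P[n' ya xb]].
- by apply/le_anti; rewrite xy yx.
- by rewrite (le_trans xb (le_trans xy ya)) in n'.
- by rewrite (le_trans yb (le_trans yx xa)) in n.
- by rewrite (le_trans yb ya) in n.
Qed.

Let ext_le_add p x y : le_add p x y -> ext p x y.
Proof.
move=> xy; have [<-|nxy] := eqVneq x y; first by rewrite /ext eqxx leqnn orbT.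
apply/orP; left; apply: proper_card; apply/properP; split.
  by apply/fintype.subsetP => z; rewrite !inE => /le_add_trans; apply.
exists y; rewrite !inE ?/le_add ?lexx //.
by apply: contra nxy => yx; apply/eqP/(le_add_anti xy).
Qed.

Let ext_linear p : linear_extension (ext p).
Proof.
split.
- move=> x y; rewrite /ext; case: ltngtP => //= _; exact: leq_total.
- move=> x y; rewrite /ext; case: ltngtP => //= _ h.
  by apply/enum_rank_inj/val_inj/eqP; rewrite eqn_leq.
- move=> y x z /orP[xy|/andP[/eqP xy rxy]] /orP[yz|/andP[/eqP yz ryz]];
    rewrite /ext.
  + by rewrite (ltn_trans xy yz).
  + by rewrite -yz xy.
  + by rewrite xy yz.
  + by rewrite xy yz eqxx (leq_trans rxy ryz) orbT.
- by move=> x y xy; apply: ext_le_add; rewrite /le_add xy.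
Qed.

Lemma realizable_ex : exists k, (0 < k)%N && `[< realizable k >].
Proof.
exists #|{: option (T * T)}|; rewrite card_option /=; apply/asboolP.
rewrite -card_option; exists (fun i => ext (enum_val i)); split=> [i|x y xy].
  exact: ext_linear.
split=> [lt_xy i|all_xy].
  by case: (ext_linear (enum_val i)) => _ _ _; apply; exact: ltW.
rewrite lt_neqAle xy /=; apply: contraT => nxy.
have := all_xy (enum_rank (Some (y, x))); rewrite enum_rankK => Lxy.
have Lyx : ext (Some (y, x)) y x.
  by apply: ext_le_add; rewrite /le_add nxy !lexx orbT.
have [_ anti _ _] := ext_linear (Some (y, x)).
by rewrite (anti x y) ?Lxy ?eqxx // in xy.
Qed.

Definition poset_dim : nat := ex_minn realizable_ex.

End PosetDimension.

Arguments poset_dim {disp} T.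

(* [d.-tupleprod bool] is {0,1}^d with the componentwise order. *)
Definition boolean_lattice (d : nat) := d.-tupleprod bool.

Definition level (d : nat) (u : boolean_lattice d) : nat :=
  #|[set i | tnth u i]%SET|.

Definition two_levels (d j : nat) : Type :=
  {u : boolean_lattice d | (level u == j) || (level u == j.+1)}.

HB.instance Definition _ d j := Finite.on (two_levels d j).
HB.instance Definition _ d j := SubType.on (two_levels d j).
HB.instance Definition _ d j :=
  [SubChoice_isSubPOrder of two_levels d j by <: with Order.Disp tt tt].

Definition max_dim_two_levels (d : nat) : nat :=
  \max_(j < d) poset_dim (two_levels d j).

Definition hypercube_adj (d : nat) : rel (d.-tuple bool) :=
  fun u v => #|[set i | tnth u i != tnth v i]%SET| == 1%N.

Lemma hypercube_adj_sym (d : nat) : symmetric (@hypercube_adj d).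
Proof.
by move=> u v; rewrite /hypercube_adj; under eq_finset do rewrite eq_sym.
Qed.

Lemma hypercube_adj_irr (d : nat) : irreflexive (@hypercube_adj d).
Proof.
move=> u; rewrite /hypercube_adj; under eq_finset do rewrite eqxx.
by rewrite cards0.
Qed.

Definition hypercube (d : nat) : sgraph :=
  SGraph (@hypercube_adj_sym d) (@hypercube_adj_irr d).

(* Main.v *)
Require Import Defs.
From mathcomp Require Import all_boot all_order all_algebra all_fingroup.
From mathcomp Require Import boolp classical_sets reals exp.
From mathcomp Require Import zify ring lra.

(** Disjoint intervals can be met in either order, so a box representation of
    dimension k yields 2k linear extensions of any two adjacent levels; this is
    the lower bound.

    Conversely, m linear extensions for every pair of adjacent levels give
    2m + 2 interval coordinates.  For each parity, cut the levels into
    consecutive pairs and lay the pairs out from left to right as blocks, each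
    touching the next: a linear extension of a pair tells how far the lower
    vertices reach from the left end of the block and the upper ones from its
    right end.  Two more coordinates separate vertices of equal level.  Since
    b_d >= 2 for d >= 2, this is at most 3 b_d.

    Kostochka's 2k orders, available when d <= k!, then bound the boxicity by
    4k + 2, and (k - 1)! < d turns this into 12 log d / log log d for all
    d > 2 without exception; 3 b_d would be too weak here for small d. *)

Set Implicit Arguments.
Unset Strict Implicit.
Unset Printing Implicit Defensive.

Import Order.TTheory GRing.Theory Num.Theory.

Local Open Scope ring_scope.

(** * Hypercube vertices as subsets *)

Definition ones (d : nat) (u : d.-tuple bool) : {set 'I_d} := [set i | tnth u i]%SET.

Lemma ones_inj (d : nat) : injective (@ones d).
Proof.
move=> u v /setP uv; apply: eq_from_tnth => i.
by have := uv i; rewrite !inE.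
Qed.

Lemma ones_surj (d : nat) (A : {set 'I_d}) : exists u, ones u = A.
Proof. by exists [tuple i \in A | i < d]; apply/setP => i; rewrite inE tnth_mktuple. Qed.

Lemma boolean_lattice_leE (d : nat) (u v : boolean_lattice d) :
  (u <= v)%O = (ones u \subset ones v).
Proof.
rewrite leEtprod; apply/forallP/idP => [uv|/fintype.subsetP uv i].
  by apply/fintype.subsetP => i; have := uv i; rewrite !inE leEbool; do 2!case: (tnth _ i).
by have := uv i; rewrite !inE leEbool; case: (tnth u i) => [/(_ isT) ->|_].
Qed.

Lemma hypercube_adjE (d : nat) (u v : d.-tuple bool) :
  hypercube_adj u v =
  (#|ones u :\: ones v| + #|ones v :\: ones u| == 1)%N.
Proof.
rewrite /hypercube_adj -cardsUI.
have -> : (ones u :\: ones v) :&: (ones v :\: ones u) = finset.set0.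
  by apply/setP => i; rewrite !inE; do 2!case: (tnth _ i).
rewrite cards0 addn0; congr (#|pred_of_set _| == _)%N; apply/setP => i; rewrite !inE.
by do 2!case: (tnth _ i).
Qed.

Lemma hypercube_adj_ltn (d : nat) (u v : d.-tuple bool) :
  (#|ones u| <= #|ones v|)%N ->
  hypercube_adj u v = (#|ones v| == #|ones u|.+1) && (ones u \subset ones v).
Proof.
move=> uv; rewrite hypercube_adjE -finset.setD_eq0 -cards_eq0.
have := cardsID (ones v) (ones u); have := cardsID (ones u) (ones v).
rewrite finset.setIC; lia.
Qed.

(** * Box representations as families of intervals *)

Section Intervals.
Context (R : realType) (G : sgraph).

Lemma box_representable_intervals (I : finType) (l r : I -> G -> nat) :
  (forall i u, l i u <= r i u)%N ->
  (forall u v, u != v ->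
     (adj u v <-> forall i, (l i u <= r i v)%N /\ (l i v <= r i u)%N)) ->
  box_representable R G #|I|.
Proof.
move=> lr lrP.
exists (fun v => [set x | forall i : 'I_#|I|,
  (l (enum_val i) v)%:R <= x i <= (r (enum_val i) v)%:R]%classic).
split=> [v|u v uv].
  exists (fun i => (l (enum_val i) v)%:R), (fun i => (r (enum_val i) v)%:R).
  by split=> // i; rewrite ler_nat.
rewrite lrP //; split=> [h|[x [xu xv]] i].
  exists (fun i => (maxn (l (enum_val i) u) (l (enum_val i) v))%:R).
  by split=> i /=; have [h1 h2] := h (enum_val i);
    rewrite !ler_nat leq_max geq_max leqnn ?orbT !lr ?h1 ?h2.
have /andP[] := xu (enum_rank i); have /andP[] := xv (enum_rank i).
rewrite !enum_rankK -!(ler_nat R) => lv rv lu ru.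
by split; [apply: (le_trans lu rv) | apply: (le_trans lv ru)].
Qed.

Lemma intervals_of_box_representable k : box_representable R G k ->
  exists l r : 'I_k -> G -> R, (forall i u, l i u <= r i u) /\
  (forall u v, u != v -> (adj u v <-> forall i, l i u <= r i v /\ l i v <= r i u)).
Proof.
case=> f [fbox fP].
have /choice[a /choice[b ab]] := fbox.
exists (fun i u => a u i), (fun i u => b u i); split=> [i u|u v uv].
  by case: (ab u).
rewrite fP //; have [_ ->] := ab u; have [_ ->] := ab v; split.
  case=> x [xu xv] i; have /andP[h1 h2] := xu i; have /andP[h3 h4] := xv i.
  by split; [apply: (le_trans h1 h4) | apply: (le_trans h3 h2)].
move=> h; exists (fun i => Num.max (a u i) (a v i)); split=> i /=;
  have [h1 h2] := h i; have [lu _] := ab u; have [lv _] := ab v;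
  by rewrite le_max ge_max lexx ?orbT /= ?lu ?lv ?h1 ?h2.
Qed.

Lemma boxicity_le k : box_representable R G k -> (boxicity R G <= k)%N.
Proof.
by move=> Gk; rewrite /boxicity; case: ex_minnP => m _; apply; apply/asboolP.
Qed.

Lemma boxicityP : box_representable R G (boxicity R G).
Proof. by rewrite /boxicity; case: ex_minnP => m /asboolP. Qed.

End Intervals.

(** * Boxes from orders on adjacent levels *)

(** A realizer of levels [j] and [j.+1], reduced to what the boxes need: how each linear extension
    [i] compares a lower vertex with an upper one. *)
Definition level_heights (d j : nat) (I : finType) (h : I -> d.-tuple bool -> nat) :=
  forall u v, #|ones u| = j -> #|ones v| = j.+1 ->
    (ones u \subset ones v) = [forall i, h i u <= h i v]%N.

Section HypercubeBoxes.
Local Open Scope nat_scope.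
Context (d : nat) (I : finType) (i0 : I) (h : nat -> I -> d.-tuple bool -> nat).
Hypothesis hP : forall j, level_heights j (h j).
(** Exceeds all heights at levels up to [d], so no truncated [M - h] loses information. *)
Let M := (\max_(x : 'I_d.+1 * (I * d.-tuple bool)) h x.1 x.2.1 x.2.2).+1.
Let C := (bool * I + bool)%type.

(* Parity [p] pairs level [j] with [j.+1] when [j + p] is even; [q p u] is the
   left end of the block of [u], and [up p u] says that [u] is in its upper level. *)
Let q (p : bool) (u : d.-tuple bool) := ((#|ones u| + p)./2 * M.+1)%N.
Let up (p : bool) (u : d.-tuple bool) := odd (#|ones u| + p).

(** Relative to [q], a lower vertex gets [[0, M - h]] and an upper one [[M - h, M.+1]]: they meet
    iff the lower height is at most the upper one. Under [inr p], vertices at levels of parity [p]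
    become distinct points, all others the full range. The truncated predecessor at level 0 is
    harmless: no lower level is paired with it. *)
Let left_end (c : C) (u : d.-tuple bool) : nat :=
  match c with
  | inl (p, i) => q p u + if up p u then M - h #|ones u|.-1 i u else 0
  | inr p => if odd #|ones u| == p then nat_of_ord (enum_rank u) else 0
  end.

Let right_end (c : C) (u : d.-tuple bool) : nat :=
  match c with
  | inl (p, i) => q p u + if up p u then M.+1 else M - h #|ones u| i u
  | inr p => if odd #|ones u| == p then nat_of_ord (enum_rank u) else #|{: d.-tuple bool}|
  end.

Let meets (u v : d.-tuple bool) (c : C) :=
  (left_end c u <= right_end c v)%N /\ (left_end c v <= right_end c u)%N.

Let h_bound (j : nat) (i : I) (u : d.-tuple bool) : (j <= d)%N -> (h j i u < M)%N.
Proof.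
rewrite -ltnS => jd; rewrite /M ltnS.
exact: (leq_bigmax (F := fun x : 'I_d.+1 * (I * d.-tuple bool) => h x.1 x.2.1 x.2.2)
  (Ordinal jd, (i, u))).
Qed.

Let ones_bound (u : d.-tuple bool) : (#|ones u| <= d)%N.
Proof. by rewrite -[leqRHS]card_ord max_card. Qed.

Let left_right c u : (left_end c u <= right_end c u)%N.
Proof. by case: c => [[p i]|p] /=; case: ifP; lia. Qed.

Let q_eq (p : bool) (u v : d.-tuple bool) :
  (#|ones u| + p)./2 = (#|ones v| + p)./2 -> q p u = q p v.
Proof. by rewrite /q => ->. Qed.

Let q_next (p : bool) (u v : d.-tuple bool) : ((#|ones u| + p)./2 < (#|ones v| + p)./2)%N ->
  (q p u + M.+1 <= q p v)%N.
Proof. by move=> uv; rewrite /q addnC -mulSn leq_mul2r uv orbT. Qed.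

Let q_succ (p : bool) (u v : d.-tuple bool) : (#|ones v| + p)./2 = (#|ones u| + p)./2.+1 ->
  q p v = (q p u + M.+1)%N.
Proof. by rewrite /q => ->; rewrite mulSn addnC. Qed.

Let adj_meets u v c : #|ones v| = #|ones u|.+1 -> ones u \subset ones v ->
  meets u v c.
Proof.
move=> uv; rewrite (hP erefl uv) => /forallP hh.
rewrite /meets; case: c => [[p i]|p] /=.
- have := hh i; rewrite /up uv addSn /=.
  (* If [u] is upper, [v] is lower in the next block, which starts at the right end of [u]. *)
  have [o|e] := boolP (odd (#|ones u| + p)) => /= hi.
    have := @q_succ p u v; lia.
  have := @q_eq p u v; lia.
- rewrite uv /=.
  have ranku := ltnW (ltn_ord (enum_rank u)); have rankv := ltnW (ltn_ord (enum_rank v)).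
  by case: (odd _) p => [] [] /=; rewrite ?leq0n.
Qed.

Let nonadj_separated u v : u != v -> (#|ones u| <= #|ones v|)%N ->
  (forall c, meets u v c) -> #|ones v| = #|ones u|.+1 /\ ones u \subset ones v.
Proof.
move=> nuv uv sep.
have [uvE|ltuv] := leqP #|ones v| #|ones u|.
  have {uvE}uvE : #|ones v| = #|ones u| by apply/eqP; rewrite eqn_leq uvE.
  have := sep (inr (odd #|ones u|)); rewrite /meets /= uvE eqxx => -[h1 h2].
  case/eqP: nuv; apply/enum_rank_inj/val_inj/eqP.
  by rewrite eqn_leq h1.
(* Choose the parity that makes [u] lower: its interval then stops before the end of its block, so
   it misses every later block. *)
have [p lowu] : exists p : bool, odd (#|ones u| + p) = false.
  by exists (odd #|ones u|); rewrite oddD; case: (odd _).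
have [uvE|far] := eqVneq #|ones v| #|ones u|.+1; last first.
  have [_] := sep (inl (p, i0)); rewrite /= /up lowu.
  have := @q_next p u v; lia.
split=> //; rewrite (hP erefl uvE); apply/forallP => i.
have [_] := sep (inl (p, i)); rewrite /= /up lowu uvE addSn /= lowu /=.
have -> : q p v = q p u by rewrite /q uvE addSn /= uphalf_half lowu.
rewrite leq_add2l.
have := @h_bound #|ones u| i u (ones_bound u).
have := @h_bound #|ones u| i v (ones_bound u).
move: (h _ i u) (h _ i v) M => a b m; lia.
Qed.

Lemma box_representable_hypercube (R : realType) :
  box_representable R (hypercube d) (2 * #|I| + 2).
Proof.
have -> : (2 * #|I| + 2)%N = #|{: C}| by rewrite card_sum card_prod !card_bool.
apply: (@box_representable_intervals R (hypercube d) C left_end right_end) => //.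
have le_case (u v : d.-tuple bool) : u != v -> (#|ones u| <= #|ones v|)%N ->
    hypercube_adj u v <-> forall c, meets u v c.
  move=> nuv uv; rewrite hypercube_adj_ltn //; split.
    by case/andP=> /eqP h1 h2 c; apply: adj_meets.
  by case/(nonadj_separated nuv uv) => -> ->; rewrite eqxx.
move=> u v nuv; case/orP: (leq_total #|ones u| #|ones v|) => uv; first exact: le_case.
rewrite adj_sym /=; rewrite le_case 1?eq_sym //.
by split=> hm c; have [? ?] := hm c.
Qed.

End HypercubeBoxes.

(** * Kostochka's orders *)

(* [c 0] is the most significant digit. *)
Fixpoint positional (W : nat) (c : nat -> nat) (k : nat) : nat :=
  if k is k'.+1 then (positional W c k' * W + c k')%N else 0%N.

Lemma eq_positional (W k : nat) (c c' : nat -> nat) :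
  (forall s, s < k -> c s = c' s)%N -> positional W c k = positional W c' k.
Proof.
elim: k => //= k IHk cc'; rewrite IHk ?cc' // => s sk.
by apply: cc'; apply: ltnW.
Qed.

Lemma ltn_positional (W k t : nat) (c c' : nat -> nat) :
  (forall s, c s < W)%N -> (t < k)%N -> (forall s, s < t -> c s = c' s)%N ->
  (c t < c' t)%N -> (positional W c k < positional W c' k)%N.
Proof.
move=> cW; elim: k => //= k IHk; rewrite ltnS leq_eqVlt => /orP[/eqP tk|tk] eqc ltc.
  by rewrite -tk (eq_positional W eqc) ltn_add2l.
have := leq_mul (IHk tk eqc ltc) (leqnn W); have := cW k; rewrite mulSn; lia.
Qed.

(* Kostochka's bound.  Elements get distinct permutations of [k] symbols.
   The order attached to symbol [j] inspects, for t = 0, 1, ..., the part of a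
   set whose elements have [t]-th symbol [j]: first its size, then its rank in
   an arbitrary order or in the reverse of it.  If no such order puts B before
   A, where |B| = |A| + 1, then by induction on t all elements of the symmetric
   difference share their first t symbols: a symbol already used cannot recur,
   and for the others the part of B is larger than that of A or both are equal,
   so the sizes leave room for a single symbol.  Hence A is contained in B. *)
Section Kostochka.
Local Open Scope nat_scope.
Context (d k : nat) (code : 'I_d -> {perm 'I_k}) (code_inj : injective code).

Let part (A : {set 'I_d}) (j : 'I_k) (t : nat) : {set 'I_d} :=
  [set x in A | (code x)^-1%g j == t :> nat]%SET.

Let in_part A j t z :
  (z \in part A j t) = (z \in A) && ((code z)^-1%g j == t :> nat).
Proof. by rewrite !inE. Qed.

Let code_invE y j t (tk : t < k) :
  ((code y)^-1%g j == t :> nat) = (j == code y (Ordinal tk)).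
Proof.
by rewrite -(can2_eq (permKV _) (permK _)).
Qed.

Let N := #|{: {set 'I_d}}|.

Let rank (b : bool) (A : {set 'I_d}) : nat :=
  if b then nat_of_ord (enum_rank A) else N.-1 - enum_rank A.

Let digit (j : 'I_k) (b : bool) (A : {set 'I_d}) (t : nat) : nat :=
  #|part A j t| * N + rank b (part A j t).

Let key (x : 'I_k * bool) (u : d.-tuple bool) : nat :=
  positional (d.+1 * N) (digit x.1 x.2 (ones u)) k.

Let rank_lt b A : rank b A < N.
Proof.
have := ltn_ord (enum_rank A); rewrite -/N /rank.
by case: b => //; lia.
Qed.

Let rank_inj A B : (forall b, rank b A <= rank b B) -> A = B.
Proof.
move=> AB; apply/enum_rank_inj/val_inj/eqP; rewrite eqn_leq (AB true) /=.
have sub_le n a b : a < n -> b < n -> n.-1 - a <= n.-1 - b -> b <= a by lia.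
exact: sub_le (ltn_ord _) (ltn_ord _) (AB false).
Qed.

Let digit_bound j b A t : digit j b A t < d.+1 * N.
Proof.
have := rank_lt b (part A j t).
have : #|part A j t| <= d by rewrite -[leqRHS]card_ord max_card.
rewrite /digit => /(leq_mul (leqnn N)); rewrite mulSn; lia.
Qed.

Let digit_lt j b A B t : #|part A j t| < #|part B j t| ->
  digit j b A t < digit j b B t.
Proof.
move=> /(leq_mul (leqnn N)); rewrite mulnS /digit.
have := rank_lt b (part A j t); lia.
Qed.

Let key_lt x (u v : d.-tuple bool) (t : nat) : t < k ->
  (forall s, s < t -> part (ones u) x.1 s = part (ones v) x.1 s) ->
  digit x.1 x.2 (ones u) t < digit x.1 x.2 (ones v) t -> key x u < key x v.
Proof.
move=> tk prefix; apply: ltn_positional => // s st.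
by rewrite /digit prefix.
Qed.

(** The first digit that differs is at the place of symbol [x.1] in the code of the added element
    [y], where the part of [ones v] is larger by [y]. *)
Let subset_key x (u v : d.-tuple bool) : #|ones v| = #|ones u|.+1 ->
  ones u \subset ones v -> key x u <= key x v.
Proof.
move=> uv sub.
have /cards1P[y yP] : #|ones v :\: ones u| == 1.
  have := cardsID (ones u) (ones v); rewrite (finset.setIidPr sub) uv; lia.
have [yv yu] : y \in ones v /\ y \notin ones u.
  by have := finset.set11 y; rewrite -yP inE => /andP[].
have part_sub s : part (ones u) x.1 s \subset part (ones v) x.1 s.
  apply/fintype.subsetP => z; rewrite !in_part => /andP[zu ->].
  by rewrite (fintype.subsetP sub).
apply/ltnW/(key_lt (ltn_ord ((code y)^-1%g x.1))) => [s st|].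
  apply/eqP; rewrite finset.eqEsubset part_sub /=; apply/fintype.subsetP => z.
  rewrite !in_part => /andP[zv /[dup] /eqP sE ->].
  rewrite andbT; apply: contraTT st => zu.
  have : z \in ones v :\: ones u by rewrite inE zu.
  by rewrite yP inE => /eqP zy; rewrite -sE zy ltnn.
apply/digit_lt/proper_card/properP; split=> //; exists y; rewrite in_part ?yv ?eqxx //.
by rewrite (negPf yu).
Qed.

Let sum_part A t : t < k -> \sum_j #|part A j t| = #|A|.
Proof.
move=> tk; rewrite -sum1_card (partition_big (fun y => code y (Ordinal tk)) predT) //=.
apply: eq_bigr => j _; rewrite -sum1_card; apply: eq_bigl => y.
by rewrite in_part; congr (_ && _); rewrite code_invE eq_sym.
Qed.

Let key_subset (u v : d.-tuple bool) : #|ones v| = #|ones u|.+1 ->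
  (forall x, key x u <= key x v) -> ones u \subset ones v.
Proof.
move=> uv le_key; set A := ones u; set B := ones v.
pose X := (A :\: B) :|: (B :\: A).
have in_X y : (y \in X) = (y \in A) (+) (y \in B).
  by rewrite finset.in_setU !finset.in_setD; case: (y \in A); case: (y \in B).
have eq_part j t : (forall y, y \in X -> (code y)^-1%g j != t :> nat) ->
    part A j t = part B j t.
  move=> hX; apply/setP => y; rewrite !in_part; case: eqP => [yt|]; last by rewrite !andbF.
  rewrite !andbT; have := contraL (hX y); rewrite yt eqxx in_X => /(_ isT).
  by case: (y \in A); case: (y \in B).
have same t : t <= k -> forall y z s, y \in X -> z \in X -> s < t ->
    forall j, ((code y)^-1%g j == s :> nat) = ((code z)^-1%g j == s :> nat).
  elim: t => // t IHt tk y z s yX zX; rewrite ltnS leq_eqVlt => /orP[/eqP->|]; last first.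
    exact: (IHt (ltnW tk)).
  have le_part j : #|part A j t| <= #|part B j t| ?= iff (part A j t == part B j t).
    have [/exists_inP[w wX /existsP[s' /andP[s't /eqP ws']]]|none] :=
      boolP [exists w in X, exists s' : 'I_k, (s' < t) && ((code w)^-1%g j == s')].
      rewrite (@eq_part j t) ?eqxx; first exact/leqif_refl.
      move=> y' y'X; have := IHt (ltnW tk) _ _ _ wX y'X s't j.
      by rewrite ws' eqxx => /esym/eqP ->; rewrite ltn_eqF.
    have prefix s' : s' < t -> part A j s' = part B j s'.
      move=> s't; apply: eq_part => w wX; apply: contra none => /eqP ws.
      apply/exists_inP; exists w => //; apply/existsP; exists ((code w)^-1%g j).
      by rewrite ws s't eqxx.
    have dig b : digit j b A t <= digit j b B t.
      rewrite leqNgt; apply/negP => lt_dig.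
      have := le_key (j, b); rewrite leqNgt => /negP; apply.
      by apply: (key_lt tk) => // s' /prefix.
    have [lt|gt|eqc] := ltngtP #|part A j t| #|part B j t|.
    + split; first exact: ltnW.
      by rewrite (ltn_eqF lt); apply/esym/eqP => E; rewrite E ltnn in lt.
    + by have := digit_lt true gt; rewrite ltnNge dig.
    + split; rewrite ?eqc // eqxx; apply/esym/eqP/rank_inj => b.
      by have := dig b; rewrite /digit eqc leq_add2l.
  have lt_part w : w \in X ->
      #|part A (code w (Ordinal tk)) t| < #|part B (code w (Ordinal tk)) t|.
    move=> wX; rewrite (ltn_leqif (le_part _)).
    apply: contraTN wX => /eqP/setP/(_ w); rewrite !in_part permK eqxx !andbT => wAB.
    by rewrite in_X wAB addbb.
  suff jj : code y (Ordinal tk) = code z (Ordinal tk).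
  by move=> j; rewrite !(code_invE _ _ tk) jj.
  apply/eqP/negPn/negP => nyz.
  have := sum_part A tk; have := sum_part B tk; rewrite uv -/A.
  rewrite (bigD1 (code y (Ordinal tk))) //= (bigD1 (code z (Ordinal tk))) 1?eq_sym //=.
  rewrite [X in _ -> X = _ -> _](bigD1 (code y (Ordinal tk))) //=.
  rewrite [X in _ -> _ + X = _ -> _](bigD1 (code z (Ordinal tk))) 1?eq_sym //=.
  have := lt_part _ yX; have := lt_part _ zX.
  set s1 := \sum_(_ | _) _; set s2 := \sum_(_ | _) _.
  have : s2 <= s1 by apply: leq_sum => j _; rewrite le_part.
  move: (#|part A _ _|) (#|part A _ _|) (#|part B _ _|) (#|part B _ _|) #|A| s1 s2.
  by clear; lia.
have X1 y z : y \in X -> z \in X -> y = z.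
  move=> yX zX; apply/code_inj/invg_inj/permP => j; apply/val_inj/eqP.
  by rewrite (same k (leqnn _) y z _ yX zX (ltn_ord _)).
apply/fintype.subsetP => y yA; apply: contraT => yB.
have yX : y \in X by rewrite in_X yA.
(* [B] is larger, so it has an element outside [A]; by [X1] this is [y], which is not in [B]. *)
have /finset.set0Pn[z zBA] : B :\: A != finset.set0.
  rewrite finset.setD_eq0; apply: contraL (leqnn #|B|) => /subset_leq_card.
  by rewrite uv -ltnNge ltnS.
have zX : z \in X by rewrite inE zBA orbT.
by move: zBA; rewrite -(X1 _ _ yX zX) inE yA.
Qed.

Lemma level_heights_perm (j : nat) :
  exists h : 'I_k * bool -> d.-tuple bool -> nat, level_heights j h.
Proof.
exists key => u v uj vj; have uv : #|ones v| = #|ones u|.+1 by rewrite vj uj.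
apply/idP/forallP => [sub x|]; [exact: subset_key | exact: key_subset].
Qed.

End Kostochka.

(** * Linear extensions and poset dimension *)

Section Dimension.
Context {disp : Order.disp_t} (T : finPOrderType disp).

Lemma realizable_finType (I : finType) (L : I -> rel T) :
  (forall i, linear_extension (L i)) ->
  (forall x y : T, x != y -> (forall i, L i x y) -> (x < y)%O) ->
  realizable T #|I|.
Proof.
move=> linL sepL; exists (fun i => L (enum_val i)); split=> // x y nxy.
split=> [lt_xy i|all_L]; first by case: (linL (enum_val i)) => _ _ _; apply; apply: ltW.
by apply: sepL => // i; rewrite -(enum_rankK i).
Qed.

Lemma poset_dim_le (k : nat) : (0 < k)%N -> realizable T k -> (poset_dim T <= k)%N.
Proof.
move=> k0 Tk; rewrite /poset_dim; case: ex_minnP => m _; apply.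
by rewrite k0; apply/asboolP.
Qed.

Lemma poset_dimP : (0 < poset_dim T)%N /\ realizable T (poset_dim T).
Proof. by rewrite /poset_dim; case: ex_minnP => m /andP[? /asboolP]. Qed.

(** Interval ends may coincide, so ties of [key] are broken by an injective rank, itself monotone
    because comparable elements can tie. *)
Lemma linear_extension_key (R : realType) (key : T -> R) (rk : T -> nat) :
  injective rk -> (forall x y, (x < y)%O -> key x <= key y /\ (rk x <= rk y)%N) ->
  linear_extension (fun x y => (key x < key y) || (key x == key y) && (rk x <= rk y)%N).
Proof.
move=> rk_inj mono; split.
- by move=> x y; case: ltgtP => //= _; apply: leq_total.
- move=> x y; case: ltgtP => //= _ xy; apply/rk_inj/eqP; by rewrite eqn_leq.
- move=> y x z; case: (ltgtP (key x) (key y)) => //= [xy _|xy rxy].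
    by case: (ltgtP (key y) (key z)) => //= [yz _|<- _]; rewrite ?xy ?(lt_trans xy yz).
  by rewrite xy; case: ltgtP => //= _; apply: leq_trans.
- move=> x y; rewrite le_eqVlt => /orP[/eqP ->|/mono[kxy rxy]].
    by rewrite eqxx leqnn orbT.
  by rewrite rxy andbT orbC -le_eqVlt.
Qed.

End Dimension.

(** * Lower bound: linear extensions from boxes *)

Lemma card_ones_two_levels (d j : nat) (x : two_levels d j) :
  (#|ones (val x)| == j) || (#|ones (val x)| == j.+1).
Proof. exact: (valP x). Qed.

Lemma two_levels_ltE (d j : nat) (x y : two_levels d j) : (x < y)%O =
  [&& #|ones (val x)| == j, #|ones (val y)| == j.+1 & ones (val x) \subset ones (val y)].
Proof.
rewrite lt_neqAle leEsub boolean_lattice_leE -(inj_eq val_inj) -(inj_eq (@ones_inj d)).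
have [sub|] := boolP (_ \subset _); last by rewrite !andbF.
have := card_ones_two_levels x; have := card_ones_two_levels y; have := subset_leq_card sub.
rewrite !andbT -(subset_leqif_cards sub).
by move: #|_| #|_| => a b; lia.
Qed.

(* From intervals [l, r] take the order of [l] on the lower and [r] on the
   upper level, and that of [-r] on the lower and [-l] on the upper level: two
   elements with disjoint intervals come in both orders. *)
Lemma poset_dim_le_boxicity (R : realType) (d j : nat) : (1 < d)%N ->
  (poset_dim (two_levels d j) <= 2 * boxicity R (hypercube d))%N.
Proof.
move=> d1; have := boxicityP R (hypercube d).
move: (boxicity _ _) => k /intervals_of_box_representable[l [r [lr lrP]]].
(* Without coordinates all vertices would be adjacent, but the two constant vectors are not once
   [d > 1]. *)
have k0 : (0 < k)%N.
  case: k l r lr lrP => // l r _ lrP; pose u b : d.-tuple bool := [tuple b | i < d].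
  have nuv : [set i | tnth (u true) i != tnth (u false) i]%SET = finset.setT.
    by apply/setP => i; rewrite !inE !tnth_mktuple.
  have uv : u true != u false.
    apply: contraTneq isT => E; have := congr1 (fun t => tnth t (Ordinal (ltnW d1))) E.
    by rewrite !tnth_mktuple.
  have [_ adjuv] := lrP _ _ uv; have /adjuv : forall i : 'I_0,
    l i (u true) <= r i (u false) /\ l i (u false) <= r i (u true) by case.
  by rewrite /= /hypercube_adj nuv cardsT card_ord gtn_eqF.
pose upper (x : two_levels d j) := #|ones (val x)| == j.+1.
(* Ranks put the lower level first, so that ties are broken in accordance with the order. *)
pose rk (x : two_levels d j) := ((upper x) * #|{: two_levels d j}| + enum_rank x)%N.
pose key (c : bool * 'I_k) (x : two_levels d j) : R :=
  if c.1 then (if upper x then r else l) c.2 (val x)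
  else - (if upper x then l else r) c.2 (val x).
have rk_inj : injective rk.
  have mixed_radix (n a b : nat) (p q : bool) :
      (a < n -> b < n -> p * n + a = q * n + b -> a = b)%N.
    by case: p; case: q => /=; lia.
  by move=> x y /(mixed_radix _ _ _ _ _ (ltn_ord _) (ltn_ord _)) /val_inj /enum_rank_inj.
have lt_data (x y : two_levels d j) : (x < y)%O ->
    [/\ ~~ upper x, upper y &
      forall i, l i (val x) <= r i (val y) /\ l i (val y) <= r i (val x)].
  rewrite two_levels_ltE => /and3P[/eqP xj yj sub].
  split=> //; first by rewrite /upper xj ltn_eqF.
  apply/lrP; last by rewrite /= hypercube_adj_ltn xj (eqP yj) ?eqxx ?sub.
  by apply: contraTneq isT => E; move: yj; rewrite -E xj ltn_eqF.
have -> : (2 * k)%N = #|{: bool * 'I_k}| by rewrite card_prod card_bool card_ord.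
apply: poset_dim_le; first by rewrite card_prod card_bool card_ord muln_gt0.
apply: (@realizable_finType _ _ _ (fun c x y =>
  (key c x < key c y) || (key c x == key c y) && (rk x <= rk y)%N)).
  move=> [b i]; apply: linear_extension_key => // x y /lt_data[/negPf xl yu /(_ i)[h1 h2]].
  rewrite /key /rk xl yu /=; split; first by case: b; rewrite ?lerN2.
  by rewrite mul0n mul1n; apply/ltnW/ltn_addr/ltn_ord.
move=> x y nxy all_xy; apply: contraT => nlt.
have [yx|nyx] := boolP (y < x)%O.
  have [/negPf yl xu h] := lt_data _ _ yx.
  have := all_xy (true, Ordinal k0); have := all_xy (false, Ordinal k0).
  have [h1 h2] := h (Ordinal k0).
  have rkyx : (rk x <= rk y)%N = false.
    apply/negbTE; rewrite -ltnNge /rk yl xu mul0n mul1n; exact/ltn_addr/ltn_ord.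
  by rewrite /key /= yl xu rkyx !andbF !orbF => _; rewrite ltNge h1.
have nadj : ~ adj (s := hypercube d) (val x) (val y).
  move=> axy; have [uv|uv] := leqP #|ones (val x)| #|ones (val y)|.
    have := axy; rewrite /= hypercube_adj_ltn // => /andP[/eqP E sub].
    case/negP: nlt; rewrite two_levels_ltE sub E eqSS.
    have := card_ones_two_levels x; have := card_ones_two_levels y.
    by rewrite E; move: #|_| => n; lia.
  have := axy; rewrite adj_sym /= hypercube_adj_ltn ?(ltnW uv) // => /andP[/eqP E sub].
  case/negP: nyx; rewrite two_levels_ltE sub E eqSS.
  have := card_ones_two_levels x; have := card_ones_two_levels y.
  by rewrite E; move: #|_| => n; lia.
apply: contra_notT nadj => _; apply/lrP; first by rewrite (inj_eq val_inj).
(* At either level the keys are points of the interval, negated for [false], so the two orders bound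
   each left end by the other right end. *)
have key_true z i : l i (val z) <= key (true, i) z <= r i (val z).
  by rewrite /key /=; case: (upper z); rewrite lexx lr.
have key_false z i : - r i (val z) <= key (false, i) z <= - l i (val z).
  by rewrite /key /=; case: (upper z); rewrite lexx lerN2 lr.
have le_key c : key c x <= key c y.
  by case/orP: (all_xy c) => [/ltW //|/andP[/eqP ->]].
move=> i; split.
  by have := le_key (true, i); have := key_true x i; have := key_true y i; lra.
by have := le_key (false, i); have := key_false x i; have := key_false y i; lra.
Qed.

(** * Numerical estimates *)

(* With L = ln d this reduces to (2k + 1) ln (L / ln 2) <= 6 L; bound the left
   logarithm by its tangent at k, and L from below by ln (k - 1)!. *)
Section NumericBound.
Context (R : realType).
Implicit Types x y : R.

Lemma ln_le_subr1 x : 0 < x -> ln x <= x - 1.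
Proof. by move=> x0; have := @le_ln1Dx R (x - 1); rewrite subrKC; apply; lra. Qed.

Lemma lnS_le (n : nat) : ln (n.+2%:R : R) <= ln n.+1%:R + n.+1%:R^-1.
Proof.
have n0 : 0 < n.+1%:R :> R by [].
have := @ln_le_subr1 (n.+2%:R / n.+1%:R) (divr_gt0 (ltr0Sn R _) n0).
rewrite ln_div ?posrE // -[n.+2]addn1 natrD mulrDl mul1r divff ?gt_eqF //.
by rewrite lerBlDl (addrC 1) addrK.
Qed.

Lemma lnS_ge (n : nat) : ln (n.+1%:R : R) + n.+2%:R^-1 <= ln n.+2%:R.
Proof.
have n0 : 0 < n.+2%:R :> R by [].
have := @ln_le_subr1 (n.+1%:R / n.+2%:R) (divr_gt0 (ltr0Sn R _) n0).
rewrite ln_div ?posrE // -[n.+2]addn1 natrD.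
have -> : n.+1%:R / (n.+1%:R + 1%:R) = 1 - (n.+1%:R + 1%:R)^-1 :> R.
  by rewrite -{1}[n.+1%:R](addrK 1%:R) mulrBl divff ?mul1r // -natrD addn1 gt_eqF.
by rewrite (addrAC 1) subrr add0r lerBlDl lerBrDr.
Qed.

(** A weak Stirling bound: the inductive step amounts to [ln n.+2 - ln n.+1] being at most
    [n.+1%:R^-1]. *)
Lemma ln_fact_ge (n : nat) : n%:R * (ln n.+1%:R - 1) <= ln (n`!%:R : R).
Proof.
elim: n => [|n IHn]; first by rewrite mul0r fact0 ln1.
have f0 : (0 : R) < n`!%:R by rewrite ltr0n fact_gt0.
rewrite factS natrM lnM ?posrE ?ltr0Sn //.
have n0 : 0 < n.+1%:R :> R by [].
have : n.+1%:R * (ln n.+2%:R - ln n.+1%:R) <= 1 :> R.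
  by rewrite mulrC -ler_pdivlMr // div1r lerBlDl lnS_le.
move: IHn; move: (ln n.+2%:R) (ln n.+1%:R) (ln n`!%:R) => b a c.
by rewrite -[n.+1]addn1 natrD; lra.
Qed.

(** [ln 12 - ln 6] is at least [1/7 + ... + 1/12], which exceeds [50/77]. *)
Lemma ln2_ge : 50 / 77 <= ln (2 : R).
Proof.
have E : ln (12%:R : R) = ln 6%:R + ln 2%:R by rewrite -lnM ?posrE // -natrM.
have := lnS_ge 5; have := lnS_ge 6; have := lnS_ge 7; have := lnS_ge 8.
have := lnS_ge 9; have := lnS_ge 10; lra.
Qed.

Lemma ln2_le1 : ln (2 : R) <= 1.
Proof. by have := @ln_le_subr1 2; lra. Qed.

Lemma ln3_bounds : 3 / 2 * ln 2 <= ln (3 : R) <= 8 / 5 * ln 2.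
Proof.
have h1 : ln (2 ^+ 3 : R) <= ln (3 ^+ 2) by rewrite ler_ln ?posrE; lra.
have h2 : ln (3 ^+ 5 : R) <= ln (2 ^+ 8) by rewrite ler_ln ?posrE; lra.
move: h1 h2; rewrite !lnXn; lra.
Qed.

Lemma ln_fact_bound (k d : nat) : (2 < d)%N -> (2 < k)%N -> (k.-1`! < d)%N ->
  (2 * k%:R + 1) * (ln k%:R - 1) <=
  ln (d%:R : R) * (6 - (2 * k%:R + 1) / (k%:R * ln 2)).
Proof.
move=> d2 k2 kd.
have u_lb := ln2_ge; have u_ub := ln2_le1; have /andP[t_lb t_ub] := ln3_bounds.
have u0 : 0 < ln 2 :> R by lra.
pose w : R := (ln 2)^-1.
have uw : ln 2 * w = 1 by rewrite divff ?gt_eqF.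
have w_ub : w <= 77 / 50 by rewrite invf_ple ?posrE ?divr_gt0 // invf_div.
have w0 : 0 <= w by rewrite invr_ge0 ltW.
have -> : (2 * k%:R + 1) / (k%:R * ln 2) = (2 + k%:R^-1) * w :> R.
  by rewrite invfM mulrA mulrDl mul1r mulfK // pnatr_eq0; case: k k2 {kd}.
have L_ge x : x <= ln (k.-1`!.+1)%:R -> 0 <= 6 - (2 + k%:R^-1) * w ->
    x * (6 - (2 + k%:R^-1) * w) <= ln d%:R * (6 - (2 + k%:R^-1) * w).
  move=> xk c0; apply: ler_wpM2r => //; apply: (le_trans xk).
  by rewrite ler_ln ?posrE ?ltr0n ?ler_nat //; apply: leq_trans kd.
have ln4 : ln (4 : R) = 2 * ln 2.
  by rewrite (_ : 4 = 2 ^+ 2) ?lnXn //; lra.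
(* The lower bounds for [ln d] are [ln 3], [ln 6 >= 5/2 ln 2] and [ln 24 >= 9/2 ln 2] for k = 3, 4,
   5, and come from [ln_fact_ge] beyond. *)
case: k k2 kd L_ge => [|[|[|k]]] // _; case: k => [|[|[|k]]] kd L_ge.
- have tw : ln 3 * w <= 8 / 5 by rewrite ler_pdivrMr; lra.
  have := L_ge (ln 3) (lexx _).
  by move: (ln 3) t_lb t_ub tw {L_ge} => t; lra.
- have h6 : ln (2 * 3 : R) <= ln 7 by rewrite ler_ln ?posrE; lra.
  have := L_ge (5 / 2 * ln 2); rewrite /= ln4.
  have : 5 / 2 * ln 2 <= ln (3`!.+1%:R : R) by move: h6; rewrite lnM ?posrE //; lra.
  move=> h /(_ h); lra.
- have h24 : ln (2 ^+ 3 * 3 : R) <= ln 25 by rewrite ler_ln ?posrE; lra.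
  have h5 : ln (5 ^+ 3 : R) <= ln (2 ^+ 7) by rewrite ler_ln ?posrE; lra.
  have := L_ge (9 / 2 * ln 2); rewrite /=.
  have : 9 / 2 * ln 2 <= ln (4`!.+1%:R : R).
    by move: h24; rewrite lnM ?lnXn ?posrE ?exprn_gt0 //; lra.
  move=> h /(_ h); move: h5; rewrite !lnXn //; lra.
- have [K KE] : exists K : R, K = k.+3.+3%:R by exists k.+3.+3%:R.
  rewrite -KE in L_ge *.
  have K6 : 6 <= K by rewrite KE ler_nat.
  have KV : K * K^-1 = 1 by rewrite divff // gt_eqF //; lra.
  have KV0 : 0 < K^-1 by rewrite invr_gt0; lra.
  have y0 : 0 <= ln K - 1.
    have : ln (4 : R) <= ln K by rewrite ler_ln ?posrE; lra.
    by rewrite ln4; lra.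
  have LK : (K - 1) * (ln K - 1) <= ln (k.+2.+3)`!.+1%:R.
    have -> : K - 1 = k.+2.+3%:R by rewrite KE -[k.+3.+3]addn1 natrD addrK.
    rewrite KE; apply: (le_trans (@ln_fact_ge _)).
    by rewrite ler_ln ?posrE ?ltr0n ?fact_gt0 // ler_nat.
  have KV6 : K^-1 <= 6^-1 by rewrite lef_pV2 ?posrE; lra.
  have c_ge : 6 - (2 + K^-1) * (77 / 50) <= 6 - (2 + K^-1) * w.
    by rewrite lerD2l lerN2 ler_wpM2l // addr_ge0 // ltW.
  (* With [77/50] for [w] this holds from [K = 6] on but fails at [K = 5], hence the separate small
     cases. *)
  have Kc : 2 * K + 1 <= (K - 1) * (6 - (2 + K^-1) * w).
    have K1 : 0 <= K - 1 by lra.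
    apply: (le_trans _ (ler_wpM2l K1 c_ge)).
    have -> : (K - 1) * (6 - (2 + K^-1) * (77 / 50)) =
      6 * K - 6 - 77 / 50 * (2 * K - 2 + K * K^-1 - K^-1) by ring.
    rewrite KV; lra.
  have := L_ge _ LK; move=> /(_ (le_trans _ c_ge)) h.
  apply: (le_trans (ler_wpM2r y0 Kc)); rewrite mulrAC; apply: h; lra.
Qed.

End NumericBound.

Lemma loglog_bound (R : realType) (k d : nat) :
  (2 < d)%N -> (2 < k)%N -> (k.-1`! < d)%N ->
  (4 * k + 2)%:R <= 12 * log2 (d%:R : R) / log2 (log2 (d%:R : R)).
Proof.
move=> d2 k2 kd; have := ln_fact_bound R d2 k2 kd.
have u0 : 0 < ln 2 :> R by rewrite ln_gt0 // ltr1n.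
have k0 : 0 < k%:R :> R by rewrite ltr0n; apply: leq_trans k2.
have l1 : 1 < ln d%:R / ln 2 :> R.
  by rewrite ltr_pdivlMr // mul1r ltr_ln ?posrE ?ltr_nat // ltr0n (ltn_trans _ d2).
set L := ln d%:R in l1 *; rewrite /log2 -/L.
have ll0 : 0 < ln (L / ln 2) by rewrite ln_gt0.
have tangent : ln (L / ln 2) <= ln k%:R + (L / (k%:R * ln 2) - 1).
  have x0 : 0 < L / ln 2 / k%:R by rewrite divr_gt0 // (lt_trans _ l1).
  have := ln_le_subr1 x0; rewrite ln_div ?posrE // ?(lt_trans _ l1) //.
  by rewrite lerBlDl -mulrA -invfM [ln 2 * _]mulrC.
move=> h; rewrite ler_pdivlMr ?divr_gt0 // natrD natrM.
have -> : (4%:R * k%:R + 2%:R) * (ln (L / ln 2) / ln 2) =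
  2 * ((2 * k%:R + 1) * ln (L / ln 2)) / ln 2 by ring.
rewrite [leRHS]mulrA ler_pM2r ?invr_gt0 //.
have : (2 * k%:R + 1) * ln (L / ln 2) <=
       (2 * k%:R + 1) * (ln k%:R + (L / (k%:R * ln 2) - 1)).
  by rewrite ler_pM2l // addr_gt0 // mulr_gt0.
lra.
Qed.

(** * Assembling the bounds *)

Lemma realizable_leq (disp : Order.disp_t) (T : finPOrderType disp) (m n : nat) :
  (0 < m <= n)%N -> realizable T m -> realizable T n.
Proof.
case/andP=> m0 mn [L [linL LP]].
(* Indices from [m] on repeat the extension with index 0. *)
pose pad (i : 'I_n) : 'I_m := insubd (Ordinal m0) (i : nat).
exists (fun i => L (pad i)); split=> [i|x y nxy]; first exact: linL.
rewrite LP //; split=> [h i|h i]; first exact: h.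
have -> : i = pad (widen_ord mn i) by apply: val_inj; rewrite val_insubd /= ltn_ord.
exact: h.
Qed.

(** The height of a vertex is the size of its down-set in [L i]; down-sets of a linear order form a
    chain, so sizes compare as the order does. *)
Lemma level_heights_realizable (d j k : nat) : realizable (two_levels d j) k ->
  exists h : 'I_k -> d.-tuple bool -> nat, level_heights j h.
Proof.
case=> L [linL LP].
pose below (i : 'I_k) (u : d.-tuple bool) := [set w : two_levels d j |
  if insub u is Some u' then L i w u' else false]%SET.
have below_val i (w x : two_levels d j) : (w \in below i (val x)) = L i w x.
  by rewrite inE valK.
exists (fun i u => #|below i u|) => u v uj vj.
have [x ux] : exists x : two_levels d j, val x = u.
  have Pu : (level u == j) || (level u == j.+1) by rewrite /level -/(ones u) uj eqxx.
  by exists (Sub u Pu); rewrite SubK.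
have [y vy] : exists y : two_levels d j, val y = v.
  have Pv : (level v == j) || (level v == j.+1) by rewrite /level -/(ones v) vj eqxx orbT.
  by exists (Sub v Pv); rewrite SubK.
have nxy : x != y.
  by apply: contraTneq isT => E; move: vj; rewrite -vy -E ux uj => /n_Sn.
have -> : ones u \subset ones v = (x < y)%O.
  by rewrite two_levels_ltE ux vy uj vj !eqxx.
rewrite -ux -vy; apply/idP/forallP => [/(LP _ _ nxy) Lxy i|le_below].
  have [_ _ trL _] := linL i; apply/subset_leq_card/fintype.subsetP => w.
  by rewrite !below_val => /trL; apply.
apply/(LP _ _ nxy) => i; have [totL _ trL refL] := linL i.
have /orP[//|Lyx] := totL x y.
have sub : below i (val y) \subset below i (val x).
  by apply/fintype.subsetP => w; rewrite !below_val => /trL; apply.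
have /eqP E : below i (val y) == below i (val x) by rewrite finset.eqEcard sub le_below.
by rewrite -below_val E below_val refL.
Qed.

Lemma boxicity_hypercube_le (R : realType) (d : nat) (I : finType) : (0 < #|I|)%N ->
  (forall j, (j < d)%N -> exists h : I -> d.-tuple bool -> nat, level_heights j h) ->
  (boxicity R (hypercube d) <= 2 * #|I| + 2)%N.
Proof.
move=> /card_gt0P[i0 _] hP.
have /choice[h hh] j : exists h : I -> d.-tuple bool -> nat, level_heights j h.
  (* From [j = d] on there is no upper vertex, so any heights will do. *)
  have [/hP //|dj] := ltnP j d; exists (fun _ _ => 0%N) => u v _ vj.
  have : (#|ones v| <= d)%N by rewrite -[leqRHS]card_ord max_card.
  by rewrite vj ltnNge dj.
exact/boxicity_le/(box_representable_hypercube i0 hh).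
Qed.

(** Distinct singletons are incomparable, which no single linear order can express; this lets the
    two extra coordinates fit into [3 b_d]. *)
Lemma max_dim_two_levels_gt1 (d : nat) : (1 < d)%N -> (1 < max_dim_two_levels d)%N.
Proof.
move=> d1; apply: leq_trans (leq_bigmax (Ordinal (ltnW d1))) => /=.
have [] := poset_dimP (two_levels d 0).
case: (poset_dim _) => [|[|//]] // _ [L [linL LP]].
have atom (i : 'I_d) : exists x : two_levels d 0, ones (val x) = finset.set1 i.
  have [u uE] := ones_surj (finset.set1 i).
  have Pu : (level u == 0) || (level u == 1) by rewrite /level -/(ones u) uE cards1.
  by exists (Sub u Pu); rewrite SubK.
have [x xE] := atom (Ordinal (ltnW d1)); have [y yE] := atom (Ordinal d1).
have nxy : x != y.
  apply: contraTneq isT => E; move: xE; rewrite E yE => /setP/(_ (Ordinal d1)).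
  by rewrite !inE eqxx.
have [totL _ _ _] := linL ord0.
have /orP[Lxy|Lyx] := totL x y.
  have /(LP _ _ nxy) : forall i, L i x y by move=> i; rewrite (ord1 i).
  by rewrite two_levels_ltE xE cards1.
have /(LP y x) : forall i, L i y x by move=> i; rewrite (ord1 i).
by rewrite eq_sym two_levels_ltE yE cards1 => /(_ nxy).
Qed.

Lemma boxicity_le_max_dim (R : realType) (d : nat) : (0 < max_dim_two_levels d)%N ->
  (boxicity R (hypercube d) <= 2 * max_dim_two_levels d + 2)%N.
Proof.
move=> b0; rewrite -{1}(card_ord (max_dim_two_levels d)).
apply: boxicity_hypercube_le; rewrite ?card_ord // => j jd.
have [dim0 dimP] := poset_dimP (two_levels d j).
apply/level_heights_realizable/(realizable_leq _ dimP); rewrite dim0 /=.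
exact: (leq_bigmax (Ordinal jd)).
Qed.

Lemma boxicity_hypercube1 (R : realType) : boxicity R (hypercube 1) = 0%N.
Proof.
apply/eqP; rewrite -leqn0; apply: boxicity_le.
rewrite -[X in box_representable _ _ X]card_void.
apply: (@box_representable_intervals _ _ _ (fun _ _ => 0%N) (fun _ _ => 0%N)) => // u v uv.
split=> [_ []|_]; rewrite /= /hypercube_adj.
rewrite (_ : [set i | _]%SET = finset.setT) ?cardsT ?card_ord //.
apply/setP => i; rewrite !inE; apply: contra_neq uv => E.
by apply: eq_from_tnth => i'; rewrite !(ord1 i') -(ord1 i).
Qed.

Lemma boxicity_le_fact (R : realType) (d k : nat) : (0 < k)%N -> (d <= k`!)%N ->
  (boxicity R (hypercube d) <= 4 * k + 2)%N.
Proof.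
move=> k0 dk; have cardI : #|{: 'I_k * bool}| = (2 * k)%N.
  by rewrite card_prod card_bool card_ord mulnC.
have -> : (4 * k + 2 = 2 * #|{: 'I_k * bool}| + 2)%N by rewrite cardI mulnA.
rewrite -card_Sn in dk.
apply: boxicity_hypercube_le; first by rewrite cardI muln_gt0.
move=> j _; apply: (@level_heights_perm _ _ (fun i => enum_val (widen_ord dk i))).
by move=> i i' /enum_val_inj /(congr1 val) /= /val_inj.
Qed.

Theorem theorem5 (R : realType) (d : nat) (d_gt0 : (0 < d)%N) :
  [/\ (1 < d)%N ->
        2^-1 * (max_dim_two_levels d)%:R <= (boxicity R (hypercube d))%:R :> R,
      (boxicity R (hypercube d))%:R <= 3 * (max_dim_two_levels d)%:R :> R
    & (2 < d)%N ->
        (boxicity R (hypercube d))%:R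
          <= 12 * log2 (d%:R : R) / log2 (log2 (d%:R : R))].
Proof.
split=> [d1||d2].
- rewrite mulrC ler_pdivrMr // mulrC -natrM ler_nat.
  by apply/bigmax_leqP => j _; apply: poset_dim_le_boxicity.
(* For [d = 1] the two levels form a chain and [b_d = 1], so [2 b_d + 2] exceeds [3 b_d]; but the
   graph is complete. *)
- have [d1|d1] := ltnP 1 d; last first.
    have -> : d = 1%N by apply/eqP; rewrite eqn_leq d1 d_gt0.
    by rewrite boxicity_hypercube1 mulr_ge0.
  rewrite -natrM ler_nat; have b1 := max_dim_two_levels_gt1 d1.
  apply: (leq_trans (boxicity_le_max_dim R (ltnW b1))).
  by rewrite [leqRHS]mulSn addnC leq_add2r.
- have ex_k : exists k, (d <= k`!)%N by exists d; apply: fact_geq.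
  (* For the least [k] with [d <= k!], minimality gives [(k - 1)! < d], and [d > 2] excludes
     [k <= 2]. *)
  case: (ex_minnP ex_k) => k dk k_min.
  have k2 : (2 < k)%N.
    rewrite ltnNge; apply/negP => k2; move: (leq_trans d2 dk).
    by case: k k2 {dk k_min} => [|[|[]]].
  have kd : (k.-1`! < d)%N.
    rewrite ltnNge; apply/negP => /k_min.
    by rewrite leqNgt prednK ?leqnn //; apply: ltn_trans k2.
  apply: le_trans (loglog_bound R d2 k2 kd); rewrite ler_nat.
  by apply: boxicity_le_fact => //; apply: ltn_trans k2.
Qed.
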